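(* Let $\mathfrak S$ be a $k$-linear Grothendieck category and let $(A,C,\psi)$ be an entwining structure over $k$. Suppose that the functor $(C,-):\mathfrak S\to\mathfrak S$ is exact. Then the category ${}^{[C,-]}_{A}\mathfrak S(\psi)$ of entwined contramodule objects in $\mathfrak S$ over $(A,C,\psi)$ is an abelian category.
   Context: $k$ is a field of characteristic zero and $\otimes=\otimes_k$. For $\mathcal M\in\mathfrak S$, $\mathcal M\otimes-:Mod_k\to\mathfrak S$ is the left adjoint of $\mathfrak S(\mathcal M,-):\mathfrak S\to Mod_k$; we also write $V\otimes\mathcal M$ for $\mathcal M\otimes V$. For $V\in Mod_k$, $(V,-):\mathfrak S\to\mathfrak S$ is the right adjoint of $V\otimes-$; this is a bifunctor $Mod_k^{op}\times\mathfrak S\to\mathfrak S$ with $(k,\mathcal M)=\mathcal M$ and $(V,(V',\mathcal M))\cong(V'\otimes V,\mathcal M)$. Write $(V,V',\mathcal M):=(V,(V',\mathcal M))=(V'\otimes V,\mathcal M)$, and for linear $f$ write $(f,\mathcal M)$ for the induced map; an object in a slot of a morphism denotes the identity. $(A,\mu,\eta)$ is a $k$-algebra and $(C,\Delta,\epsilon)$ a $k$-coalgebra. An entwining structure $(A,C,\psi)$ is a linear map $\psi:C\otimes A\to A\otimes C$ with $\psi(C\otimes\mu)=(\mu\otimes C)(A\otimes\psi)(\psi\otimes A)$, $\psi(C\otimes\eta)=\eta\otimes C$, $(A\otimes\Delta)\psi=(\psi\otimes C)(C\otimes\psi)(\Delta\otimes A)$, $(A\otimes\epsilon)\psi=\epsilon\otimes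 A$. It induces $(\psi,\mathcal M):(C,A,\mathcal M)\to(A,C,\mathcal M)$. A left $A$-module object is $(\mathcal M,\mu_{\mathcal M}:\mathcal M\to(A,\mathcal M))$ with $(\mu,\mathcal M)\mu_{\mathcal M}=(A,\mu_{\mathcal M})\mu_{\mathcal M}$ and $(\eta,\mathcal M)\mu_{\mathcal M}=id$. A left $C$-contramodule object is $(\mathcal M,\pi_{\mathcal M}:(C,\mathcal M)\to\mathcal M)$ with $\pi_{\mathcal M}(\epsilon,\mathcal M)=id$ and $\pi_{\mathcal M}(\Delta,\mathcal M)=\pi_{\mathcal M}(C,\pi_{\mathcal M})$. Objects of ${}^{[C,-]}_{A}\mathfrak S(\psi)$ are triples $(\mathcal M,\pi_{\mathcal M},\mu_{\mathcal M})$ with both structures such that $\mu_{\mathcal M}\pi_{\mathcal M}=(A,\pi_{\mathcal M})(\psi,\mathcal M)(C,\mu_{\mathcal M})$; morphisms are maps in $\mathfrak S$ preserving both structures. *)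

(* Defs.v *)
From HB Require Import structures.
From mathcomp Require Import all_boot all_algebra.
From mathcomp Require Import sesquilinear boolp.

Set Implicit Arguments.
Unset Strict Implicit.
Unset Printing Implicit Defensive.

Import GRing.Theory.
Local Open Scope ring_scope.
Local Open Scope quotient_scope.

Section LinearMaps.
Variables (k : fieldType) (U V : lmodType k).
Implicit Types f g h : {linear U -> V}.

Lemma linear_ext f g : f =1 g -> f = g.
Proof.
case: f g => [f [[af] [sf]]] [g [[ag] [sg]]] /= /funext fg.
rewrite -[LHS]/(GRing.Linear.Pack _) -[RHS]/(GRing.Linear.Pack _).
by subst g; congr (GRing.Linear.Pack (GRing.Linear.Class _ _));
  congr (_ _); apply: Prop_irrelevance.
Qed.

HB.instance Definition _ := gen_eqMixin {linear U -> V}.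
HB.instance Definition _ := gen_choiceMixin {linear U -> V}.

Definition linmap_zero : {linear U -> V} := \0.
Definition linmap_opp f : {linear U -> V} := \- f.
Definition linmap_add f g : {linear U -> V} := f \+ g.
Definition linmap_scale (a : k) f : {linear U -> V} := a \*: f.

Lemma linmap_addA : associative linmap_add.
Proof. by move=> f g h; apply: linear_ext => u /=; rewrite addrA. Qed.
Lemma linmap_addC : commutative linmap_add.
Proof. by move=> f g; apply: linear_ext => u /=; rewrite addrC. Qed.
Lemma linmap_add0 : left_id linmap_zero linmap_add.
Proof. by move=> f; apply: linear_ext => u /=; rewrite add0r. Qed.
Lemma linmap_addN : left_inverse linmap_zero linmap_opp linmap_add.
Proof. by move=> f; apply: linear_ext => u /=; rewrite addNr. Qed.

HB.instance Definition _ := GRing.isZmodule.Build {linear U -> V}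
  linmap_addA linmap_addC linmap_add0 linmap_addN.

Lemma linmap_scaleA a b f :
  linmap_scale a (linmap_scale b f) = linmap_scale (a * b) f.
Proof. by apply: linear_ext => u /=; rewrite scalerA. Qed.
Lemma linmap_scale1 : left_id 1 linmap_scale.
Proof. by move=> f; apply: linear_ext => u /=; rewrite scale1r. Qed.
Lemma linmap_scaleDr : right_distributive linmap_scale +%R.
Proof. by move=> a f g; apply: linear_ext => u /=; rewrite scalerDr. Qed.
Lemma linmap_scaleDl f : {morph linmap_scale^~ f : a b / a + b}.
Proof. by move=> a b; apply: linear_ext => u /=; rewrite scalerDl. Qed.

HB.instance Definition _ := GRing.Zmodule_isLmodule.Build k {linear U -> V}
  linmap_scaleA linmap_scale1 linmap_scaleDr linmap_scaleDl.

End LinearMaps.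

Definition mklin (k : fieldType) (U V : lmodType k) (f : U -> V)
    (lf : linear f) : {linear U -> V} :=
  HB.pack f (GRing.isLinear.Build k U V *:%R f lf).

Definition bilinear_map (k : fieldType) (V W X : lmodType k)
    (b : V -> W -> X) : Prop :=
  (forall w, linear (b^~ w)) /\ (forall v, linear (b v)).

(* The list [:: (v_1, w_1); ...; (v_n, w_n)] stands for the formal sum
   v_1 (x) w_1 + ... + v_n (x) w_n; two formal sums are identified when no
   bilinear map separates them.  The lemmas [pure_bilinear], [tens_liftE] and
   [tens_ext] are the universal property. *)
Section TensorProduct.
Variables (k : fieldType) (V W : lmodType k).
Implicit Types (X : lmodType k) (s t : seq (V * W)).

Definition tens_eval X (b : V -> W -> X) s : X := \sum_(p <- s) b p.1 p.2.

Definition tens_eqv s t : bool :=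
  `[< forall X (b : V -> W -> X), bilinear_map b ->
        tens_eval b s = tens_eval b t >].

Lemma tens_eqvP s t :
  reflect (forall X (b : V -> W -> X), bilinear_map b ->
             tens_eval b s = tens_eval b t) (tens_eqv s t).
Proof. exact: asboolP. Qed.

Lemma tens_eqv_refl : reflexive tens_eqv.
Proof. by move=> s; apply/tens_eqvP. Qed.
Lemma tens_eqv_sym : symmetric tens_eqv.
Proof. by move=> s t; apply/tens_eqvP/tens_eqvP => e X b /e. Qed.
Lemma tens_eqv_trans : transitive tens_eqv.
Proof.
move=> t s u /tens_eqvP est /tens_eqvP etu; apply/tens_eqvP => X b bb.
by rewrite est ?etu.
Qed.

Canonical tens_equiv :=
  EquivRel tens_eqv tens_eqv_refl tens_eqv_sym tens_eqv_trans.

Definition tensor := {eq_quot tens_equiv}.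
HB.instance Definition _ := Choice.on tensor.
HB.instance Definition _ := EqQuotient.on tensor.

Lemma tensP s t : reflect (\pi_tensor s = \pi_tensor t) (tens_eqv s t).
Proof. exact: eqmodP. Qed.

Lemma tens_evalD X (b : V -> W -> X) s t :
  tens_eval b (s ++ t) = tens_eval b s + tens_eval b t.
Proof. exact: big_cat. Qed.

Definition tens_scale_repr (a : k) s := [seq (a *: p.1, p.2) | p <- s].

Lemma tens_evalZ X (b : V -> W -> X) a s : bilinear_map b ->
  tens_eval b (tens_scale_repr a s) = a *: tens_eval b s.
Proof.
move=> [bl _]; rewrite /tens_eval big_map scaler_sumr; apply: eq_bigr => p _ /=.
exact: (GRing.scalable_linear (bl p.2)).
Qed.

Definition tens_zero : tensor := \pi_tensor [::].
Definition tens_add (x y : tensor) : tensor := \pi_tensor (repr x ++ repr y).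
Definition tens_scale (a : k) (x : tensor) : tensor :=
  \pi_tensor (tens_scale_repr a (repr x)).
Definition tens_opp : tensor -> tensor := tens_scale (- 1).

Definition tens_ev X (b : V -> W -> X) (x : tensor) : X := tens_eval b (repr x).

Lemma tens_ev_pi X (b : V -> W -> X) s : bilinear_map b ->
  tens_ev b (\pi_tensor s) = tens_eval b s.
Proof. by move=> bb; apply: (tens_eqvP _ _ _) bb; apply/tensP; rewrite reprK. Qed.

Lemma tens_evP (x y : tensor) :
  (forall X (b : V -> W -> X), bilinear_map b -> tens_ev b x = tens_ev b y) ->
  x = y.
Proof. by move=> e; rewrite -[x]reprK -[y]reprK; apply/tensP/tens_eqvP. Qed.

Lemma tens_ev0 X (b : V -> W -> X) : bilinear_map b -> tens_ev b tens_zero = 0.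
Proof. by move=> bb; rewrite tens_ev_pi // /tens_eval big_nil. Qed.
Lemma tens_evD X (b : V -> W -> X) x y : bilinear_map b ->
  tens_ev b (tens_add x y) = tens_ev b x + tens_ev b y.
Proof. by move=> bb; rewrite tens_ev_pi // tens_evalD. Qed.
Lemma tens_evZ X (b : V -> W -> X) a x : bilinear_map b ->
  tens_ev b (tens_scale a x) = a *: tens_ev b x.
Proof. by move=> bb; rewrite tens_ev_pi // tens_evalZ. Qed.

Definition tens_evE := (tens_ev0, tens_evD, tens_evZ).

Lemma tens_addA : associative tens_add.
Proof. by move=> x y z; apply: tens_evP => X b bb; rewrite !tens_evE // addrA. Qed.
Lemma tens_addC : commutative tens_add.
Proof. by move=> x y; apply: tens_evP => X b bb; rewrite !tens_evE // addrC. Qed.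
Lemma tens_add0 : left_id tens_zero tens_add.
Proof. by move=> x; apply: tens_evP => X b bb; rewrite !tens_evE // add0r. Qed.
Lemma tens_addN : left_inverse tens_zero tens_opp tens_add.
Proof.
by move=> x; apply: tens_evP => X b bb; rewrite !tens_evE // scaleN1r addNr.
Qed.

HB.instance Definition _ := GRing.isZmodule.Build tensor
  tens_addA tens_addC tens_add0 tens_addN.

Lemma tens_scaleA a b x : tens_scale a (tens_scale b x) = tens_scale (a * b) x.
Proof. by apply: tens_evP => X f bf; rewrite !tens_evE // scalerA. Qed.
Lemma tens_scale1 : left_id 1 tens_scale.
Proof. by move=> x; apply: tens_evP => X b bb; rewrite !tens_evE // scale1r. Qed.
Lemma tens_scaleDr : right_distributive tens_scale +%R.
Proof.
by move=> a x y; apply: tens_evP => X b bb; rewrite !tens_evE // scalerDr.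
Qed.
Lemma tens_scaleDl x : {morph tens_scale^~ x : a b / a + b}.
Proof.
by move=> a b; apply: tens_evP => X f bf; rewrite !tens_evE // scalerDl.
Qed.

HB.instance Definition _ := GRing.Zmodule_isLmodule.Build k tensor
  tens_scaleA tens_scale1 tens_scaleDr tens_scaleDl.

Definition pure (v : V) (w : W) : tensor := \pi_tensor [:: (v, w)].

Lemma tens_ev_pure X (b : V -> W -> X) v w : bilinear_map b ->
  tens_ev b (pure v w) = b v w.
Proof. by move=> bb; rewrite tens_ev_pi // /tens_eval big_seq1. Qed.

Lemma pure_bilinear : bilinear_map pure.
Proof.
split=> [w|v] a x y; apply: tens_evP => X b bb;
  rewrite tens_evD ?tens_evZ ?tens_ev_pure //.
  by rewrite (bb.1 w a x y).
by rewrite (bb.2 v a x y).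
Qed.

Lemma tens_ev_linear X (b : V -> W -> X) : bilinear_map b -> linear (tens_ev b).
Proof. by move=> bb a x y; rewrite tens_evD ?tens_evZ. Qed.

Definition tens_lift X (b : V -> W -> X) (bb : bilinear_map b) :
  {linear tensor -> X} := mklin (tens_ev_linear bb).

Lemma tens_liftE X (b : V -> W -> X) (bb : bilinear_map b) v w :
  tens_lift bb (pure v w) = b v w.
Proof. exact: tens_ev_pure. Qed.

Lemma tens_sum_pure (x : tensor) : x = \sum_(p <- repr x) pure p.1 p.2.
Proof.
apply: tens_evP => X b bb; rewrite -[tens_ev b (\sum_(p <- _) _)]/(tens_lift bb _).
by rewrite linear_sum; apply: eq_bigr => p _; rewrite tens_liftE.
Qed.

Lemma tens_ext X (f g : {linear tensor -> X}) :
  (forall v w, f (pure v w) = g (pure v w)) -> f =1 g.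
Proof.
by move=> e x; rewrite [x]tens_sum_pure !linear_sum; apply: eq_bigr => p _.
Qed.

End TensorProduct.

Notation "V \ot W" := (tensor V W) (at level 40, left associativity) : type_scope.
Notation "v \pt w" := (pure v w) (at level 40, left associativity) : ring_scope.

Definition lid (k : fieldType) (V : lmodType k) : {linear V -> V} := idfun.
Arguments lid {k} V.

Section TensorMaps.
Variable k : fieldType.
Implicit Types U V W : lmodType k.

Lemma tens_map_bilinear V V' W W' (f : {linear V -> V'}) (g : {linear W -> W'}) :
  bilinear_map (fun v w => f v \pt g w).
Proof.
split=> [w|v] a x y; rewrite linearP.
  exact: (pure_bilinear V' W').1.
exact: (pure_bilinear V' W').2.
Qed.
Definition tens_map V V' W W' (f : {linear V -> V'}) (g : {linear W -> W'}) :
  {linear V \ot W -> V' \ot W'} := tens_lift (tens_map_bilinear f g).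

(* the isomorphisms k (x) V = V and V (x) k = V *)
Lemma tens_unitl_bilinear V : bilinear_map (fun (a : k^o) (v : V) => a *: v).
Proof.
split=> [v|b] a x y; first by rewrite scalerDl scalerA.
by rewrite scalerDr !scalerA mulrC.
Qed.
Definition tens_unitl V : {linear k^o \ot V -> V} :=
  tens_lift (tens_unitl_bilinear V).

Lemma tens_unitr_bilinear V : bilinear_map (fun (v : V) (a : k^o) => a *: v).
Proof.
split=> [b|v] a x y; last by rewrite scalerDl scalerA.
by rewrite scalerDr !scalerA mulrC.
Qed.
Definition tens_unitr V : {linear V \ot k^o -> V} :=
  tens_lift (tens_unitr_bilinear V).

(* the isomorphism (U (x) V) (x) W = U (x) (V (x) W) and its inverse *)
Section Associator.
Variables U V W : lmodType k.

Lemma tens_assoc1_bilinear (w : W) :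
  bilinear_map (fun (u : U) (v : V) => u \pt (v \pt w)).
Proof.
split=> [v|u] a x y; first exact: (pure_bilinear U (V \ot W)).1.
by rewrite (pure_bilinear V W).1 (pure_bilinear U (V \ot W)).2.
Qed.
Lemma tens_assoc_bilinear :
  bilinear_map (fun (t : U \ot V) (w : W) => tens_lift (tens_assoc1_bilinear w) t).
Proof.
split=> [w|t] a x y; first by rewrite linearP.
pose f := tens_lift (tens_assoc1_bilinear (a *: x + y)).
pose g : {linear U \ot V -> U \ot (V \ot W)} :=
  a *: tens_lift (tens_assoc1_bilinear x) + tens_lift (tens_assoc1_bilinear y).
apply: (@tens_ext _ _ _ _ f g) => u v.
rewrite /f tens_liftE -[g _]/(a *: tens_lift _ _ + tens_lift _ _) !tens_liftE.
by rewrite (pure_bilinear V W).2 (pure_bilinear U (V \ot W)).2.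
Qed.
Definition tens_assoc : {linear (U \ot V) \ot W -> U \ot (V \ot W)} :=
  tens_lift tens_assoc_bilinear.

Lemma tens_assocV1_bilinear (u : U) :
  bilinear_map (fun (v : V) (w : W) => (u \pt v) \pt w).
Proof.
split=> [w|v] a x y; last exact: (pure_bilinear (U \ot V) W).2.
by rewrite (pure_bilinear U V).2 (pure_bilinear (U \ot V) W).1.
Qed.
Lemma tens_assocV_bilinear :
  bilinear_map (fun (u : U) (t : V \ot W) => tens_lift (tens_assocV1_bilinear u) t).
Proof.
split=> [t|u] a x y; last by rewrite linearP.
pose f := tens_lift (tens_assocV1_bilinear (a *: x + y)).
pose g : {linear V \ot W -> (U \ot V) \ot W} :=
  a *: tens_lift (tens_assocV1_bilinear x) + tens_lift (tens_assocV1_bilinear y).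
apply: (@tens_ext _ _ _ _ f g) => v w.
rewrite /f tens_liftE -[g _]/(a *: tens_lift _ _ + tens_lift _ _) !tens_liftE.
by rewrite (pure_bilinear U V).1 (pure_bilinear (U \ot V) W).1.
Qed.
Definition tens_assocV : {linear U \ot (V \ot W) -> (U \ot V) \ot W} :=
  tens_lift tens_assocV_bilinear.

Lemma tens_assocE u v w : tens_assoc ((u \pt v) \pt w) = u \pt (v \pt w).
Proof. by rewrite /tens_assoc !tens_liftE. Qed.
Lemma tens_assocVE u v w : tens_assocV (u \pt (v \pt w)) = (u \pt v) \pt w.
Proof. by rewrite /tens_assocV !tens_liftE. Qed.

End Associator.
End TensorMaps.

Arguments tens_unitl {k V}.
Arguments tens_unitr {k V}.
Arguments tens_assoc {k U V W}.
Arguments tens_assocV {k U V W}.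

Notation "f \otm g" := (tens_map f g) (at level 40, left associativity) : ring_scope.

(* MathComp's [algType] requires 1 != 0; here the zero algebra is allowed, and
   the structure maps are the ones used to form (mu, M) and (eta, M). *)
Record algebra (k : fieldType) := Algebra {
  alg_sort :> lmodType k;
  alg_mul : {linear alg_sort \ot alg_sort -> alg_sort};
  alg_unit : {linear k^o -> alg_sort};
  alg_mulA :
    alg_mul \o (alg_mul \otm lid alg_sort)
      =1 alg_mul \o (lid alg_sort \otm alg_mul) \o tens_assoc;
  alg_mul1l : alg_mul \o (alg_unit \otm lid alg_sort) =1 tens_unitl;
  alg_mul1r : alg_mul \o (lid alg_sort \otm alg_unit) =1 tens_unitr
}.

Record coalgebra (k : fieldType) := Coalgebra {
  coalg_sort :> lmodType k;
  coalg_comul : {linear coalg_sort -> coalg_sort \ot coalg_sort};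
  coalg_counit : {linear coalg_sort -> k^o};
  coalg_comulA :
    tens_assoc \o (coalg_comul \otm lid coalg_sort) \o coalg_comul
      =1 (lid coalg_sort \otm coalg_comul) \o coalg_comul;
  coalg_comul1l : tens_unitl \o (coalg_counit \otm lid coalg_sort) \o coalg_comul
      =1 id;
  coalg_comul1r : tens_unitr \o (lid coalg_sort \otm coalg_counit) \o coalg_comul
      =1 id
}.

Arguments alg_mul {k} _.
Arguments alg_unit {k} _.
Arguments coalg_comul {k} _.
Arguments coalg_counit {k} _.

(* The second axiom is psi (C (x) eta) = eta (x) C, read on elements of C
   through C (x) k = C = k (x) C. *)
Record entwining (k : fieldType) (A : algebra k) (C : coalgebra k) := Entwining {
  entw :> {linear C \ot A -> A \ot C};
  entw_mul :
    entw \o (lid C \otm alg_mul A) \o tens_assoc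
      =1 (alg_mul A \otm lid C) \o tens_assocV \o (lid A \otm entw)
           \o tens_assoc \o (entw \otm lid A);
  entw_unit : forall c : C, entw (c \pt alg_unit A 1) = alg_unit A 1 \pt c;
  entw_comul :
    (lid A \otm coalg_comul C) \o entw
      =1 tens_assoc \o (entw \otm lid C) \o tens_assocV \o (lid C \otm entw)
           \o tens_assoc \o (coalg_comul C \otm lid A);
  entw_counit :
    tens_unitr \o (lid A \otm coalg_counit C) \o entw
      =1 tens_unitl \o (coalg_counit C \otm lid A)
}.

Record lincat (k : fieldType) := LinCat {
  ob :> Type;
  hom : ob -> ob -> lmodType k;
  idm : forall M, hom M M;
  compm : forall M N P, hom N P -> hom M N -> hom M P;
  comp1m : forall M N (f : hom M N), compm (idm N) f = f;
  compm1 : forall M N (f : hom M N), compm f (idm M) = f;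
  compmA : forall M N P Q (h : hom P Q) (g : hom N P) (f : hom M N),
    compm h (compm g f) = compm (compm h g) f;
  compm_linl : forall M N P (f : hom M N),
    linear (fun g : hom N P => compm g f);
  compm_linr : forall M N P (g : hom N P), linear (fun f : hom M N => compm g f)
}.

Arguments hom {k l} M N.
Arguments idm {k l} M.
Notation "g \co f" := (compm g f) (at level 40, left associativity).

Section LinCatTheory.
Variables (k : fieldType) (S : lincat k).
Implicit Types M N P X : S.

Definition postcomp M N P (g : hom N P) : {linear hom M N -> hom M P} :=
  mklin (compm_linr (M := M) g).
Definition precomp M N P (f : hom M N) : {linear hom N P -> hom M P} :=
  mklin (compm_linl (P := P) f).

Definition is_mono M N (f : hom M N) : Prop :=
  forall X (g h : hom X M), f \co g = f \co h -> g = h.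

Definition is_epi M N (f : hom M N) : Prop :=
  forall X (g h : hom N X), g \co f = h \co f -> g = h.

Definition is_zero_object M : Prop :=
  forall X, (exists! f : hom M X, True) /\ (exists! f : hom X M, True).

Definition is_biproduct M N P (i1 : hom M P) (i2 : hom N P)
    (p1 : hom P M) (p2 : hom P N) : Prop :=
  [/\ p1 \co i1 = idm M, p2 \co i2 = idm N, p1 \co i2 = 0, p2 \co i1 = 0
    & i1 \co p1 + i2 \co p2 = idm P].

Definition is_kernel K M N (i : hom K M) (f : hom M N) : Prop :=
  f \co i = 0 /\
  forall X (g : hom X M), f \co g = 0 -> exists! h : hom X K, i \co h = g.

Definition is_cokernel M N Q (f : hom M N) (p : hom N Q) : Prop :=
  p \co f = 0 /\
  forall X (g : hom N X), g \co f = 0 -> exists! h : hom Q X, h \co p = g.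

(* 0 -> M -> N -> P -> 0 *)
Definition short_exact M N P (f : hom M N) (g : hom N P) : Prop :=
  is_kernel f g /\ is_cokernel f g.

Definition abelian_category : Prop :=
  [/\ exists Z : S, is_zero_object Z,
      forall M N, exists P (i1 : hom M P) (i2 : hom N P) (p1 : hom P M)
        (p2 : hom P N), is_biproduct i1 i2 p1 p2,
      forall M N (f : hom M N),
        (exists K (i : hom K M), is_kernel i f) /\
        (exists Q (p : hom N Q), is_cokernel f p),
      forall M N (f : hom M N), is_mono f ->
        exists P (g : hom N P), is_kernel f g
    & forall M N (f : hom M N), is_epi f ->
        exists P (g : hom P M), is_cokernel g f].

Definition is_coproduct (I : Type) (F : I -> S) (P : S)
    (inj : forall i, hom (F i) P) : Prop :=
  forall X (g : forall i, hom (F i) X),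
    exists! h : hom P X, forall i, h \co inj i = g i.

Definition is_generator (G : S) : Prop :=
  forall M N (f g : hom M N), (forall h : hom G M, f \co h = g \co h) -> f = g.

End LinCatTheory.

(* Universes are not polymorphic here, so the objects of a small category, and
   the index types of coproducts below, live in universes of their own, which
   are never required to contain the (larger) type of objects of a [lincat]. *)
Record small_category := SmallCategory {
  sob :> Type;
  shom : sob -> sob -> Type;
  sid : forall i, shom i i;
  scomp : forall i j l, shom j l -> shom i j -> shom i l;
  scomp1m : forall i j (a : shom i j), scomp (sid j) a = a;
  scompm1 : forall i j (a : shom i j), scomp a (sid i) = a;
  scompA : forall i j l m (c : shom l m) (b : shom j l) (a : shom i j),
    scomp c (scomp b a) = scomp (scomp c b) a
}.

Definition filtered (J : small_category) : Prop :=
  [/\ inhabited J,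
      forall i j : J, exists l : J, inhabited (shom i l) /\ inhabited (shom j l)
    & forall (i j : J) (a b : shom i j),
        exists (l : J) (c : shom j l), scomp c a = scomp c b].

Record diagram (J : small_category) (k : fieldType) (S : lincat k) := Diagram {
  dob :> J -> S;
  dmap : forall i j, shom i j -> hom (dob i) (dob j);
  dmap1 : forall i, dmap (sid i) = idm (dob i);
  dmapM : forall i j l (b : shom j l) (a : shom i j),
    dmap (scomp b a) = dmap b \co dmap a
}.

Section Grothendieck.
Variables (k : fieldType) (S : lincat k).

Definition is_cocone (J : small_category) (D : diagram J S) (L : S)
    (c : forall j, hom (D j) L) : Prop :=
  forall i j (a : shom i j), c j \co dmap D a = c i.

Definition is_colimit (J : small_category) (D : diagram J S) (L : S)
    (c : forall j, hom (D j) L) : Prop :=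
  is_cocone c /\
  forall X (g : forall j, hom (D j) X), is_cocone g ->
    exists! h : hom L X, forall j, h \co c j = g j.

Definition is_natural (J : small_category) (D E : diagram J S)
    (t : forall j, hom (D j) (E j)) : Prop :=
  forall i j (a : shom i j), t j \co dmap D a = dmap E a \co t i.

Definition filtered_colimits_exact : Prop :=
  forall (J : small_category) (D1 D2 D3 : diagram J S)
    (s : forall j, hom (D1 j) (D2 j)) (t : forall j, hom (D2 j) (D3 j))
    (L1 L2 L3 : S) (c1 : forall j, hom (D1 j) L1)
    (c2 : forall j, hom (D2 j) L2) (c3 : forall j, hom (D3 j) L3)
    (f : hom L1 L2) (g : hom L2 L3),
  filtered J -> is_natural s -> is_natural t ->
  (forall j, short_exact (s j) (t j)) ->
  is_colimit c1 -> is_colimit c2 -> is_colimit c3 ->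
  (forall j, f \co c1 j = c2 j \co s j) ->
  (forall j, g \co c2 j = c3 j \co t j) ->
  short_exact f g.

Definition grothendieck_category : Prop :=
  [/\ abelian_category S,
      forall (I : Type) (F : I -> S),
        exists (P : S) (inj : forall i, hom (F i) P), is_coproduct inj,
      filtered_colimits_exact
    & exists G : S, is_generator G].

End Grothendieck.

Record functor (k : fieldType) (S T : lincat k) := Functor {
  fob :> S -> T;
  fmap : forall M N, hom M N -> hom (fob M) (fob N);
  fmap1 : forall M, fmap (idm M) = idm (fob M);
  fmapM : forall M N P (g : hom N P) (f : hom M N),
    fmap (g \co f) = fmap g \co fmap f
}.

Arguments fmap {k S T} F {M N} f : rename.

Definition exact_functor (k : fieldType) (S T : lincat k) (F : functor S T) : Prop :=
  forall M N P (f : hom M N) (g : hom N P),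
    short_exact f g -> short_exact (fmap F f) (fmap F g).

Record adjunction (k : fieldType) (S T : lincat k)
    (F : functor S T) (G : functor T S) := Adjunction {
  adj : forall X Y, hom (F X) Y -> hom X (G Y);
  adjV : forall X Y, hom X (G Y) -> hom (F X) Y;
  adjK : forall X Y, cancel (@adj X Y) (@adjV X Y);
  adjVK : forall X Y, cancel (@adjV X Y) (@adj X Y);
  adj_nat : forall X X' Y Y' (f : hom X' X) (g : hom Y Y') (h : hom (F X) Y),
    adj (g \co h \co fmap F f) = fmap G g \co adj h \co f
}.

Arguments adj {k S T F G} _ {X Y} _.
Arguments adjV {k S T F G} _ {X Y} _.

Section AdjunctionTheory.
Variables (k : fieldType) (S T : lincat k) (F : functor S T) (G : functor T S).
Variable a : adjunction F G.

Definition adj_unit X : hom X (G (F X)) := adj a (idm (F X)).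
Definition adj_counit Y : hom (F (G Y)) Y := adjV a (idm (G Y)).

Lemma adj_natl X X' Y (f : hom X' X) (h : hom (F X) Y) :
  adj a (h \co fmap F f) = adj a h \co f.
Proof. by have := adj_nat a f (idm Y) h; rewrite fmap1 !comp1m. Qed.
Lemma adj_natr X Y Y' (g : hom Y Y') (h : hom (F X) Y) :
  adj a (g \co h) = fmap G g \co adj a h.
Proof. by have := adj_nat a (idm X) g h; rewrite fmap1 !compm1. Qed.
Lemma adjV_natl X X' Y (f : hom X' X) (h : hom X (G Y)) :
  adjV a (h \co f) = adjV a h \co fmap F f.
Proof. by apply: (can_inj (@adjK _ _ _ _ _ a _ _)); rewrite adj_natl !adjVK. Qed.
Lemma adjV_natr X Y Y' (g : hom Y Y') (h : hom X (G Y)) :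
  adjV a (fmap G g \co h) = g \co adjV a h.
Proof. by apply: (can_inj (@adjK _ _ _ _ _ a _ _)); rewrite adj_natr !adjVK. Qed.

Lemma adjE X Y (h : hom (F X) Y) : adj a h = fmap G h \co adj_unit X.
Proof. by rewrite -adj_natr compm1. Qed.
Lemma adjVE X Y (h : hom X (G Y)) : adjV a h = adj_counit Y \co fmap F h.
Proof. by rewrite -adjV_natl comp1m. Qed.
Lemma fmap_adjE Y Y' (g : hom Y Y') : fmap G g = adj a (g \co adj_counit Y).
Proof. by rewrite adj_natr adjVK compm1. Qed.

Lemma adjV_linear_right :
  (forall Y Y', linear (fun g : hom Y Y' => fmap G g)) ->
  forall X Y, linear (fun h : hom X (G Y) => adjV a h).
Proof.
move=> linG X Y b u v; apply: (can_inj (@adjK _ _ _ _ _ a _ _)).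
by rewrite [RHS]adjE linG (compm_linl (adj_unit X)) -!adjE !adjVK.
Qed.

Lemma fmap_linear_left :
  (forall X X', linear (fun f : hom X X' => fmap F f)) ->
  forall Y Y', linear (fun g : hom Y Y' => fmap G g).
Proof.
move=> linF Y Y' b u v; rewrite fmap_adjE (compm_linl (adj_counit Y)).
apply: (can_inj (@adjVK _ _ _ _ _ a _ _)); rewrite adjK.
by rewrite [RHS]adjVE linF compm_linr -!adjVE !fmap_adjE !adjK.
Qed.

End AdjunctionTheory.

Section Vect.
Variable k : fieldType.
Implicit Types U V W X : lmodType k.

Definition Vect_comp (U V W : lmodType k) (g : {linear V -> W})
  (f : {linear U -> V}) : {linear U -> W} := g \o f.

Lemma Vect_comp1m U V (f : {linear U -> V}) : Vect_comp (lid V) f = f.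
Proof. exact: linear_ext. Qed.
Lemma Vect_compm1 U V (f : {linear U -> V}) : Vect_comp f (lid U) = f.
Proof. exact: linear_ext. Qed.
Lemma Vect_compmA U V W X (h : {linear W -> X}) (g : {linear V -> W})
  (f : {linear U -> V}) : Vect_comp h (Vect_comp g f) = Vect_comp (Vect_comp h g) f.
Proof. exact: linear_ext. Qed.
Lemma Vect_comp_linl U V W (f : {linear U -> V}) :
  linear (fun g : {linear V -> W} => Vect_comp g f).
Proof. by move=> a g h; apply: linear_ext. Qed.
Lemma Vect_comp_linr U V W (g : {linear V -> W}) :
  linear (fun f : {linear U -> V} => Vect_comp g f).
Proof. by move=> a f h; apply: linear_ext => u /=; rewrite linearP. Qed.

Definition Vect : lincat k := @LinCat k (lmodType k)
  (fun V W => {linear V -> W} : lmodType k) (@lid k) Vect_comp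
  Vect_comp1m Vect_compm1 Vect_compmA Vect_comp_linl Vect_comp_linr.

End Vect.

Section HomFunctor.
Variables (k : fieldType) (S : lincat k) (M : S).

Definition hom_map N N' (f : hom N N') :
  hom (hom M N : Vect k) (hom M N' : Vect k) := postcomp M f.

Lemma hom_map1 N : hom_map (idm N) = idm (hom M N : Vect k).
Proof. by apply: linear_ext => h; apply: comp1m. Qed.
Lemma hom_mapM N N' N'' (g : hom N' N'') (f : hom N N') :
  hom_map (g \co f) = hom_map g \co hom_map f.
Proof. by apply: linear_ext => h; apply/esym/compmA. Qed.

Definition hom_functor : functor S (Vect k) :=
  @Functor k S (Vect k) (fun N => hom M N) hom_map hom_map1 hom_mapM.

End HomFunctor.

(* A choice, for every M, of a left adjoint V |-> V (x) M of S(M, -). *)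
Record tensoring (k : fieldType) (S : lincat k) := Tensoring {
  tensF : forall M : S, functor (Vect k) S;
  tensF_adj : forall M : S, adjunction (tensF M) (hom_functor M)
}.

Section Tensoring.
Variables (k : fieldType) (S : lincat k) (T : tensoring S).
Implicit Types (V W : lmodType k) (M N X : S).

Definition tensO V M : S := tensF T M V.

(* the canonical map V -> S(M, V (x) M) *)
Definition tens_in V M : {linear V -> hom M (tensO V M)} :=
  adj_unit (tensF_adj T M) V.

(* the map V (x) M -> N corresponding to a linear map V -> S(M, N) *)
Definition tens_out V M N (f : {linear V -> hom M N}) : hom (tensO V M) N :=
  adjV (tensF_adj T M) (f : hom (V : Vect k) (hom_functor M N)).

Lemma tens_outE V M N (f : {linear V -> hom M N}) v :
  tens_out f \co tens_in V M v = f v.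
Proof.
rewrite -[LHS]/((fmap (hom_functor M) (tens_out f)
  \co adj_unit (tensF_adj T M) V : {linear V -> hom M N}) v).
by rewrite -adjE /tens_out adjVK.
Qed.

Lemma tens_outP V M N (g h : hom (tensO V M) N) :
  (forall v, g \co tens_in V M v = h \co tens_in V M v) -> g = h.
Proof.
move=> e; apply: (can_inj (@adjK _ _ _ _ _ (tensF_adj T M) _ _)).
by rewrite !adjE; apply: linear_ext => v; apply: e.
Qed.

Definition tens_fmap V M N (f : hom M N) : hom (tensO V M) (tensO V N) :=
  tens_out (Vect_comp (precomp (tensO V N) f) (tens_in V N)).

Lemma tens_fmapE V M N (f : hom M N) v :
  tens_fmap V f \co tens_in V M v = tens_in V N v \co f.
Proof. by rewrite tens_outE. Qed.

Lemma tens_fmap1 V M : tens_fmap V (idm M) = idm (tensO V M).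
Proof. by apply: tens_outP => v; rewrite tens_fmapE compm1 comp1m. Qed.

Lemma tens_fmapM V M N P (g : hom N P) (f : hom M N) :
  tens_fmap V (g \co f) = tens_fmap V g \co tens_fmap V f.
Proof.
by apply: tens_outP => v; rewrite -compmA !tens_fmapE [RHS]compmA tens_fmapE -compmA.
Qed.

Definition tens V : functor S S := Functor (tens_fmap1 V) (tens_fmapM V).

Lemma tens_fmap_linear V M N : linear (@tens_fmap V M N).
Proof.
move=> a f g; apply: tens_outP => v; rewrite [RHS]compm_linl. rewrite /= !tens_fmapE.
exact: compm_linr.
Qed.

(* the map f (x) M : V (x) M -> W (x) M *)
Definition tensm V W (f : {linear V -> W}) M : hom (tens V M) (tens W M) :=
  fmap (tensF T M) (f : hom (V : Vect k) W).

Lemma tensmE V W (f : {linear V -> W}) M v :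
  tensm f M \co tens_in V M v = tens_in W M (f v).
Proof.
rewrite -[LHS]/((fmap (hom_functor M) (fmap (tensF T M) (f : hom (V : Vect k) W))
  \co adj_unit (tensF_adj T M) V : {linear V -> hom M (tensO W M)}) v).
by rewrite -adjE -[fmap _ _]comp1m adj_natl.
Qed.

(* the isomorphism V (x) (W (x) M) = (V (x) W) (x) M and its inverse *)
Section Assoc.
Variables (V W : lmodType k) (M : S).

Lemma tens_assoc_in_linear (v : V) :
  linear (fun w : W => tens_in (V \ot W) M (v \pt w)).
Proof. by move=> a x y; rewrite (pure_bilinear V W).2 linearP. Qed.

Lemma tens_assoc_out_linear :
  linear (fun v : V => tens_out (mklin (tens_assoc_in_linear v))).
Proof.
move=> a x y; apply: tens_outP => w.
rewrite (compm_linl (tens_in W M w)) !tens_outE /=.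
by rewrite (pure_bilinear V W).1 linearP.
Qed.

Definition act_assoc : hom (tens V (tens W M)) (tens (V \ot W) M) :=
  tens_out (mklin tens_assoc_out_linear).

Lemma tens_assocV_bilinear_in : bilinear_map (fun (v : V) (w : W) =>
  tens_in V (tens W M) v \co tens_in W M w).
Proof.
split=> [w|v] a x y; rewrite linearP; first exact: compm_linl.
exact: compm_linr.
Qed.

Definition act_assocV : hom (tens (V \ot W) M) (tens V (tens W M)) :=
  tens_out (tens_lift tens_assocV_bilinear_in).

Lemma act_assocE v w :
  act_assoc \co tens_in V (tens W M) v \co tens_in W M w
  = tens_in (V \ot W) M (v \pt w).
Proof. by rewrite !tens_outE. Qed.

Lemma act_assocVE v w :
  act_assocV \co tens_in (V \ot W) M (v \pt w)
  = tens_in V (tens W M) v \co tens_in W M w.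
Proof. by rewrite tens_outE tens_liftE. Qed.

Lemma act_assocK : act_assocV \co act_assoc = idm _.
Proof.
apply: tens_outP => v; apply: tens_outP => w.
by rewrite comp1m -!compmA (compmA act_assoc) act_assocE act_assocVE.
Qed.

Lemma act_assocVK : act_assoc \co act_assocV = idm _.
Proof.
apply: tens_outP => x; rewrite comp1m.
pose f : {linear V \ot W -> hom M (tens (V \ot W) M)} :=
  Vect_comp (postcomp M (act_assoc \co act_assocV)) (tens_in (V \ot W) M).
apply: (@tens_ext _ _ _ _ f (tens_in (V \ot W) M)) => v w.
by rewrite -[LHS]compmA act_assocVE compmA act_assocE.
Qed.

End Assoc.

(* the isomorphism k (x) M = M and its inverse *)
Section Unit.
Variable M : S.

Lemma scale_id_linear : linear (fun a : k^o => a *: idm M).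
Proof. by move=> a x y; rewrite scalerDl scalerA. Qed.

Definition act_unit : hom (tens k^o M) M := tens_out (mklin scale_id_linear).
Definition act_unitV : hom M (tens k^o M) := tens_in k^o M 1.

Lemma act_unitK : act_unitV \co act_unit = idm _.
Proof.
apply: tens_outP => a; rewrite comp1m -compmA tens_outE /=.
rewrite [LHS](GRing.scalable_linear (compm_linr _)) compm1 /act_unitV -linearZ.
by rewrite -[a *: 1]/(a * 1) mulr1.
Qed.

Lemma act_unitVK : act_unit \co act_unitV = idm _.
Proof. by rewrite tens_outE /= scale1r. Qed.

End Unit.

Arguments act_assoc V W M : clear implicits.
Arguments act_assocV V W M : clear implicits.
Arguments act_unit M : clear implicits.

Lemma act_unit_nat M N (f : hom M N) :
  act_unit N \co fmap (tens k^o) f = f \co act_unit M.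
Proof.
apply: tens_outP => a; rewrite -[LHS]compmA tens_fmapE compmA -[RHS]compmA.
rewrite !tens_outE /= [RHS](GRing.scalable_linear (compm_linr f)) compm1.
by rewrite [LHS](GRing.scalable_linear (compm_linl f)) comp1m.
Qed.

Lemma act_assoc_nat V W M N (f : hom M N) :
  act_assoc V W N \co fmap (tens V) (fmap (tens W) f)
  = fmap (tens (V \ot W)) f \co act_assoc V W M.
Proof.
apply: tens_outP => v; apply: tens_outP => w.
transitivity (tens_in (V \ot W) N (v \pt w) \co f).
  rewrite -(compmA _ _ (tens_in V _ v)) tens_fmapE compmA -[LHS]compmA tens_fmapE.
  by rewrite compmA act_assocE.
by rewrite -2!compmA (compmA (act_assoc _ _ _)) act_assocE tens_fmapE.
Qed.

Lemma act_assocV_nat V W M N (f : hom M N) :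
  act_assocV V W N \co fmap (tens (V \ot W)) f
  = fmap (tens V) (fmap (tens W) f) \co act_assocV V W M.
Proof.
rewrite -[LHS]compm1 -(act_assocVK V W M) compmA -(compmA _ _ (act_assoc V W M)).
by rewrite -act_assoc_nat (compmA _ (act_assoc V W N)) act_assocK comp1m.
Qed.

(* A choice, for every V, of a right adjoint (V, -) of V (x) -. *)
Record cotensoring := Cotensoring {
  cot : lmodType k -> functor S S;
  cot_adj : forall V, adjunction (tens V) (cot V)
}.

End Tensoring.

Arguments act_assoc {k S T} V W M.
Arguments act_assocV {k S T} V W M.
Arguments act_unit {k S T} M.
Arguments act_unitV {k S T} M.

Section Cotensoring.
Variables (k : fieldType) (S : lincat k) (T : tensoring S) (H : cotensoring T).
Implicit Types (V W : lmodType k) (M N X : S).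

Local Notation ev V M := (adj_counit (cot_adj H V) M).

Lemma cot_linear V M N : linear (fun f : hom M N => fmap (cot H V) f).
Proof. exact: (fmap_linear_left (cot_adj H V) (tens_fmap_linear T V)). Qed.

(* (f, M), the mate of f (x) - : V (x) - -> W (x) - *)
Definition cotm V W (f : {linear V -> W}) M : hom (cot H W M) (cot H V M) :=
  adj (cot_adj H V) (ev W M \co tensm T f (cot H W M)).

(* The isomorphism (V, (W, M)) = (W (x) V, M) and its inverse, obtained from
   W (x) (V (x) X) = (W (x) V) (x) X. *)
Definition cot_assoc V W M : hom (cot H V (cot H W M)) (cot H (W \ot V) M) :=
  adj (cot_adj H (W \ot V))
    (ev W M \co fmap (tens T W) (ev V (cot H W M)) \co act_assocV W V _).

Definition cot_assocV V W M : hom (cot H (W \ot V) M) (cot H V (cot H W M)) :=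
  adj (cot_adj H V) (adj (cot_adj H W) (ev (W \ot V) M \co act_assoc W V _)).

(* the isomorphism (k, M) = M and its inverse *)
Definition cot_unit M : hom (cot H k^o M) M := ev k^o M \co act_unitV _.
Definition cot_unitV M : hom M (cot H k^o M) := adj (cot_adj H k^o) (act_unit M).

Lemma evE V X M (h : hom (tens T V X) M) :
  ev V M \co fmap (tens T V) (adj (cot_adj H V) h) = h.
Proof. by rewrite -adjVE adjK. Qed.

Lemma adj_ev V M : adj (cot_adj H V) (ev V M) = idm _.
Proof. exact: adjVK. Qed.

Lemma cot_assocK V W M : cot_assocV V W M \co cot_assoc V W M = idm _.
Proof.
rewrite -!adj_natl -[_ \co _ \co _]compmA act_assoc_nat compmA evE -compmA.
by rewrite -2!compmA act_assocK compm1 adj_natl adj_ev comp1m adj_ev.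
Qed.

Lemma cot_assocVK V W M : cot_assoc V W M \co cot_assocV V W M = idm _.
Proof.
rewrite -adj_natl -[_ \co _ \co _]compmA act_assocV_nat compmA.
rewrite -[X in X \co act_assocV _ _ _]compmA -fmapM evE evE.
by rewrite -compmA act_assocVK compm1 adj_ev.
Qed.

Lemma cot_unitK M : cot_unitV M \co cot_unit M = idm _.
Proof.
by rewrite -adj_natl act_unit_nat -compmA act_unitK compm1 adj_ev.
Qed.

Lemma cot_unitVK M : cot_unit M \co cot_unitV M = idm M.
Proof. by rewrite -compmA -tens_fmapE compmA evE act_unitVK. Qed.

End Cotensoring.

Section Entwined.
Variables (k : fieldType) (S : lincat k) (T : tensoring S) (H : cotensoring T).
Variables (A : algebra k) (C : coalgebra k) (psi : entwining A C).

(* (psi, M) : (C, (A, M)) = (A (x) C, M) -> (C (x) A, M) = (A, (C, M)) *)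
Definition cot_psi (M : S) :
    hom (cot H C (cot H A M)) (cot H A (cot H C M)) :=
  cot_assocV H A C M \co cotm H psi M \co cot_assoc H C A M.

(* (A, (A, M)) and (A (x) A, M) are identified, as are (k, M) and
   M; the identifications are the isomorphisms [cot_assoc] and [cot_unit], mutually
   inverse to [cot_assocV] and [cot_unitV]. *)
Definition is_module (M : S) (mu : hom M (cot H A M)) : Prop :=
  cot_assocV H A A M \co cotm H (alg_mul A) M \co mu = fmap (cot H A) mu \co mu
  /\ cot_unit H M \co cotm H (alg_unit A) M \co mu = idm M.

Definition is_contramodule (M : S) (pi : hom (cot H C M) M) : Prop :=
  pi \co cotm H (coalg_counit C) M \co cot_unitV H M = idm M
  /\ pi \co cotm H (coalg_comul C) M \co cot_assoc H C C M
     = pi \co fmap (cot H C) pi.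

Record entwined := Entwined {
  eobj :> S;
  econtra : hom (cot H C eobj) eobj;
  eact : hom eobj (cot H A eobj);
  econtraP : is_contramodule econtra;
  eactP : is_module eact;
  eentw : eact \co econtra
    = fmap (cot H A) econtra \co cot_psi eobj \co fmap (cot H C) eact
}.

Definition is_ehom (M N : entwined) (f : hom (eobj M) (eobj N)) : bool :=
  (f \co econtra M == econtra N \co fmap (cot H C) f)
  && (eact N \co f == fmap (cot H A) f \co eact M).

Lemma is_ehomP M N (f : hom (eobj M) (eobj N)) :
  reflect (f \co econtra M = econtra N \co fmap (cot H C) f /\
           eact N \co f = fmap (cot H A) f \co eact M) (is_ehom f).
Proof.
by apply: (iffP andP) => [[/eqP fC /eqP fA]|[fC fA]]; split; rewrite ?fC ?fA.
Qed.

Section Hom.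
Variables M N : entwined.

Lemma is_ehom_linear (a : k) (f g : hom (eobj M) (eobj N)) :
  is_ehom f -> is_ehom g -> is_ehom (a *: f + g).
Proof.
move=> /is_ehomP[fC fA] /is_ehomP[gC gA]; apply/is_ehomP; split.
  rewrite cot_linear [LHS](compm_linl (econtra M)) fC gC.
  exact/esym/compm_linr.
rewrite cot_linear [RHS](compm_linl (eact M)) -fA -gA.
exact: compm_linr.
Qed.

Lemma is_ehom0 : @is_ehom M N 0.
Proof.
apply/is_ehomP; split.
  rewrite -[LHS]/(precomp _ (econtra M) 0) linear0.
  rewrite -[fmap _ 0]/(mklin (@cot_linear _ _ _ H C (eobj M) (eobj N)) 0) linear0.
  by rewrite -[RHS]/(postcomp _ (econtra N) 0) linear0.
rewrite -[LHS]/(postcomp _ (eact N) 0) linear0.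
rewrite -[fmap _ 0]/(mklin (@cot_linear _ _ _ H A (eobj M) (eobj N)) 0) linear0.
by rewrite -[RHS]/(precomp _ (eact M) 0) linear0.
Qed.

Lemma is_ehom_submod : GRing.subsemimod_closed (@is_ehom M N).
Proof.
split; [split=> [|f g fP gP] | move=> a f fP].
- exact: is_ehom0.
- by rewrite -[f]scale1r; apply: is_ehom_linear.
- by rewrite -[_ *: _]addr0; apply: is_ehom_linear => //; apply: is_ehom0.
Qed.

HB.instance Definition _ := GRing.isSubmodClosed.Build k
  (hom (eobj M) (eobj N)) (@is_ehom M N) is_ehom_submod.

Definition ehom := {f : hom (eobj M) (eobj N) | is_ehom f}.
HB.instance Definition _ := SubChoice.on ehom.
HB.instance Definition _ := [SubChoice_isSubLmodule of ehom by <:].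

End Hom.

Lemma eid_subproof M : is_ehom (idm (eobj M)).
Proof. by apply/is_ehomP; rewrite !fmap1 !comp1m !compm1. Qed.
Definition eid M : ehom M M := Sub (idm (eobj M)) (eid_subproof M).

Lemma ecomp_subproof M N P (g : ehom N P) (f : ehom M N) :
  is_ehom (val g \co val f).
Proof.
apply/is_ehomP; have /is_ehomP[fC fA] := valP f; have /is_ehomP[gC gA] := valP g.
split; rewrite fmapM.
  by rewrite -compmA fC compmA gC -compmA.
by rewrite compmA gA -compmA fA compmA.
Qed.
Definition ecomp M N P (g : ehom N P) (f : ehom M N) : ehom M P :=
  Sub (val g \co val f) (ecomp_subproof g f).

Lemma ecomp1m M N (f : ehom M N) : ecomp (eid N) f = f.
Proof. by apply: val_inj; rewrite /= comp1m. Qed.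
Lemma ecompm1 M N (f : ehom M N) : ecomp f (eid M) = f.
Proof. by apply: val_inj; rewrite /= compm1. Qed.
Lemma ecompmA M N P Q (h : ehom P Q) (g : ehom N P) (f : ehom M N) :
  ecomp h (ecomp g f) = ecomp (ecomp h g) f.
Proof. by apply: val_inj; rewrite /= compmA. Qed.
Lemma ecomp_linl M N P (f : ehom M N) : linear (fun g : ehom N P => ecomp g f).
Proof. by move=> a g h; apply: val_inj; apply: compm_linl. Qed.
Lemma ecomp_linr M N P (g : ehom N P) : linear (fun f : ehom M N => ecomp g f).
Proof. by move=> a f h; apply: val_inj; apply: compm_linr. Qed.

Definition entwined_category : lincat k := @LinCat k entwined
  (fun M N => ehom M N) eid ecomp ecomp1m ecompm1 ecompmA ecomp_linl ecomp_linr.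

End Entwined.

Arguments entwined_category {k S T} H {A C} psi.

(* Main.v *)
(* The structure maps of an entwined contramodule object are natural
   transformations between the functors (V, -).  Hence an entwined structure is
   created along any jointly monic family, because the right adjoint (A, -)
   preserves such families: this gives the zero object, biproducts and kernels.
   Dually it is created along an epimorphism p as soon as (C, p) and
   (C, (C, p)) are epimorphisms, which holds since (C, -) is exact: this gives
   cokernels.  So the forgetful functor creates kernels and cokernels, hence
   preserves and reflects monomorphisms and epimorphisms, and normality is
   inherited from the base category. *)
Require Import Defs.
From mathcomp Require Import all_boot all_algebra.
(* [all_algebra] shadows [hom]. *)
Import Defs.

Set Implicit Arguments.
Unset Strict Implicit.
Unset Printing Implicit Defensive.

Import GRing.Theory.
Local Open Scope ring_scope.

(** * Kernels, cokernels, monomorphisms and epimorphisms in a linear category *)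

Section LinearCategory.
Variables (k : fieldType) (S : lincat k).
Implicit Types M N P K Q X : S.

Lemma comp0m M N P (f : hom M N) : (0 : hom N P) \co f = 0.
Proof. exact: (linear0 (precomp P f)). Qed.

Lemma compm0 M N P (g : hom N P) : g \co (0 : hom M N) = 0.
Proof. exact: (linear0 (postcomp M g)). Qed.

Lemma compmDl M N P (f : hom M N) (g h : hom N P) :
  (g + h) \co f = g \co f + h \co f.
Proof. exact: (linearD (precomp P f)). Qed.

Lemma compmDr M N P (g : hom N P) (f h : hom M N) :
  g \co (f + h) = g \co f + g \co h.
Proof. exact: (linearD (postcomp M g)). Qed.

Lemma compmBl M N P (f : hom M N) (g h : hom N P) :
  (g - h) \co f = g \co f - h \co f.
Proof. exact: (linearB (precomp P f)). Qed.

Lemma compmBr M N P (g : hom N P) (f h : hom M N) :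
  g \co (f - h) = g \co f - g \co h.
Proof. exact: (linearB (postcomp M g)). Qed.

(** Long composites are kept associated to the left; this form lets a commuting square be rewritten
    in the middle of one. *)
Lemma compm_sq M N N' P X (a : hom N P) (b : hom M N) (c : hom N' P)
    (d : hom M N') (x : hom P X) :
  a \co b = c \co d -> x \co a \co b = x \co c \co d.
Proof. by move=> e; rewrite -!compmA e. Qed.

Lemma mono_zeroP M N (f : hom M N) :
  (forall X (g : hom X M), f \co g = 0 -> g = 0) -> is_mono f.
Proof.
move=> f0 X g h /eqP; rewrite -subr_eq0 -compmBr => /eqP/f0/eqP.
by rewrite subr_eq0 => /eqP.
Qed.

Lemma epi_zeroP M N (f : hom M N) :
  (forall X (g : hom N X), g \co f = 0 -> g = 0) -> is_epi f.
Proof.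
move=> f0 X g h /eqP; rewrite -subr_eq0 -compmBl => /eqP/f0/eqP.
by rewrite subr_eq0 => /eqP.
Qed.

Lemma mono_zero M N X (f : hom M N) (g : hom X M) :
  is_mono f -> f \co g = 0 -> g = 0.
Proof. by move=> mf fg; apply: mf; rewrite fg compm0. Qed.

Lemma epi_zero M N X (f : hom M N) (g : hom N X) :
  is_epi f -> g \co f = 0 -> g = 0.
Proof. by move=> ef gf; apply: ef; rewrite gf comp0m. Qed.

Lemma mono_comp M N P (g : hom N P) (f : hom M N) :
  is_mono g -> is_mono f -> is_mono (g \co f).
Proof. by move=> mg mf X a b; rewrite -!compmA => /mg/mf. Qed.

Lemma kernel_lift K M N (i : hom K M) (f : hom M N) X (g : hom X M) :
  is_kernel i f -> f \co g = 0 -> exists h : hom X K, i \co h = g.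
Proof. by move=> [_ ker] /ker[h [ih _]]; exists h. Qed.

Lemma cokernel_desc M N Q (f : hom M N) (p : hom N Q) X (g : hom N X) :
  is_cokernel f p -> g \co f = 0 -> exists h : hom Q X, h \co p = g.
Proof. by move=> [_ cok] /cok[h [hp _]]; exists h. Qed.

Lemma kernel_mono K M N (i : hom K M) (f : hom M N) :
  is_kernel i f -> is_mono i.
Proof.
move=> [fi ker] X g h e; have fig : f \co (i \co g) = 0.
  by rewrite compmA fi comp0m.
by have [u [_ uP]] := ker X _ fig; rewrite -(uP g) // -(uP h).
Qed.

Lemma cokernel_epi M N Q (f : hom M N) (p : hom N Q) :
  is_cokernel f p -> is_epi p.
Proof.
move=> [pf cok] X g h e; have gpf : g \co p \co f = 0.
  by rewrite -compmA pf compm0.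
by have [u [_ uP]] := cok X _ gpf; rewrite -(uP g) // -(uP h).
Qed.

Lemma mono_kernelP K M N (i : hom K M) (f : hom M N) : is_mono i ->
  f \co i = 0 ->
  (forall X (g : hom X M), f \co g = 0 -> exists h : hom X K, i \co h = g) ->
  is_kernel i f.
Proof.
move=> mi fi lift; split=> // X g /lift[h ih]; exists h; split=> // h' ih'.
by apply: mi; rewrite ih.
Qed.

Lemma epi_cokernelP M N Q (f : hom M N) (p : hom N Q) : is_epi p ->
  p \co f = 0 ->
  (forall X (g : hom N X), g \co f = 0 -> exists h : hom Q X, h \co p = g) ->
  is_cokernel f p.
Proof.
move=> ep pf desc; split=> // X g /desc[h hp]; exists h; split=> // h' h'p.
by apply: ep; rewrite hp.
Qed.

(** * Normality and images in an abelian category *)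

Section Abelian.
Hypothesis abS : abelian_category S.

Lemma kernel_ex M N (f : hom M N) : exists K (i : hom K M), is_kernel i f.
Proof. by have [_ _ kc _ _] := abS; case: (kc M N f). Qed.

Lemma cokernel_ex M N (f : hom M N) : exists Q (p : hom N Q), is_cokernel f p.
Proof. by have [_ _ kc _ _] := abS; case: (kc M N f). Qed.

(** Normality makes [f] the kernel of some [g]. As [g] kills [f], it factors through [p], so
    whatever [p] kills is killed by [g] and lifts along [f]. *)
Lemma mono_kernel M N Q (f : hom M N) (p : hom N Q) :
  is_mono f -> is_cokernel f p -> is_kernel f p.
Proof.
move=> mf cp; have [_ _ _ mono_ker _] := abS.
have [P [g kg]] := mono_ker _ _ _ mf.
apply: mono_kernelP mf cp.1 _ => X x px.
have [g' g'p] := cokernel_desc cp kg.1.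
by apply: (kernel_lift kg); rewrite -g'p -compmA px compm0.
Qed.

Lemma epi_cokernel M N K (f : hom M N) (i : hom K M) :
  is_epi f -> is_kernel i f -> is_cokernel i f.
Proof.
move=> ef ki; have [_ _ _ _ epi_cok] := abS.
have [P [g cg]] := epi_cok _ _ _ ef.
apply: epi_cokernelP ef ki.1 _ => X x xi.
have [g' ig'] := kernel_lift ki cg.1.
by apply: (cokernel_desc cg); rewrite -ig' compmA xi comp0m.
Qed.

(** If [g] kills [e], then [f] factors through [i \co j], where [j] is the kernel of [g]. This mono
    is the kernel of some [q]; since [q] kills [f], it factors through [p] and so kills [i]. Hence
    [i] lifts along [i \co j], which splits [j] and forces [g = 0]. *)
Lemma image_epi M N Q I (f : hom M N) (p : hom N Q) (i : hom I N)
    (e : hom M I) :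
  is_cokernel f p -> is_kernel i p -> i \co e = f -> is_epi e.
Proof.
move=> cp ki ief; apply: epi_zeroP => X g ge.
have [J [j kj]] := kernel_ex g.
have [e' je'] := kernel_lift kj ge.
have [_ _ _ mono_ker _] := abS.
have [R [q kq]] := mono_ker _ _ _ (mono_comp (kernel_mono ki) (kernel_mono kj)).
have qf : q \co f = 0 by rewrite -ief -je' !compmA -(compmA q) kq.1 comp0m.
have [q' q'p] := cokernel_desc cp qf.
have qi : q \co i = 0 by rewrite -q'p -compmA ki.1 compm0.
have [t ijt] := kernel_lift kq qi.
have jt : j \co t = idm I by apply: (kernel_mono ki); rewrite compmA ijt compm1.
by rewrite -[g]compm1 -jt compmA kj.1 comp0m.
Qed.

End Abelian.
End LinearCategory.

(** * Exact functors on epimorphisms and cokernels *)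

Lemma exact_epi (k : fieldType) (S S' : lincat k) (F : functor S S') (M N : S)
    (f : hom M N) :
  abelian_category S -> exact_functor F -> is_epi f -> is_epi (fmap F f).
Proof.
move=> abS exF ef; have [K [i ki]] := kernel_ex abS f.
have [_ cf] := exF _ _ _ i f (conj ki (epi_cokernel abS ef ki)).
exact: cokernel_epi cf.
Qed.

(** Exactness speaks of short exact sequences only, and [f] may fail to be mono. So [f] is replaced
    by its image [i]: the pair [i], [p] is short exact, and as [F] keeps the epi part [e] of [f]
    epi, a map that kills [F f] already kills [F i]. *)
Lemma exact_cokernel (k : fieldType) (S S' : lincat k) (F : functor S S')
    (M N Q : S) (f : hom M N) (p : hom N Q) :
  abelian_category S -> exact_functor F -> is_cokernel f p ->
  is_cokernel (fmap F f) (fmap F p).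
Proof.
move=> abS exF cp; have [I [i ki]] := kernel_ex abS p.
have [e ief] := kernel_lift ki cp.1.
have epe := image_epi abS cp ki ief.
have ci : is_cokernel i p.
  apply: epi_cokernelP (cokernel_epi cp) ki.1 _ => X g gi.
  by apply: (cokernel_desc cp); rewrite -ief compmA gi comp0m.
have [_ cFi] := exF _ _ _ i p (conj ki ci).
apply: epi_cokernelP (cokernel_epi cFi) _ _ => [|X g gf].
  by rewrite -ief fmapM compmA cFi.1 comp0m.
apply: (cokernel_desc cFi); apply: epi_zero (exact_epi abS exF epe) _.
by rewrite -compmA -fmapM ief.
Qed.


(** * Adjunctions and jointly monic families *)

Lemma counit_nat (k : fieldType) (S S' : lincat k) (F : functor S S')
    (G : functor S' S) (a : adjunction F G) (Y Y' : S') (g : hom Y Y') :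
  adj_counit a Y' \co fmap F (fmap G g) = g \co adj_counit a Y.
Proof. by rewrite -adjVE -[fmap G g]compm1 adjV_natr. Qed.

(** An arbitrary index type lets one construction serve three limits: [void] gives the zero object,
    [bool] biproducts, [unit] kernels. *)
Definition jointly_monic (k : fieldType) (S : lincat k) (P : S) (I : Type)
    (M : I -> S) (p : forall i, hom P (M i)) : Prop :=
  forall (X : S) (g h : hom X P), (forall i, p i \co g = p i \co h) -> g = h.

Lemma right_adjoint_monic (k : fieldType) (S S' : lincat k) (F : functor S S')
    (G : functor S' S) (a : adjunction F G) (P : S') (I : Type) (M : I -> S')
    (p : forall i, hom P (M i)) :
  jointly_monic p -> jointly_monic (fun i => fmap G (p i)).
Proof.
move=> mp X g h e; apply: (can_inj (@adjVK _ _ _ _ _ a _ _)).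
by apply: mp => i; rewrite -!adjV_natr e.
Qed.

(** * Naturality of the maps between the functors (V, -) *)

Section Naturality.
Variables (k : fieldType) (S : lincat k) (T : tensoring S) (H : cotensoring T).
Implicit Types (V W : lmodType k) (M N : S).

Lemma tensm_nat V W (f : {linear V -> W}) M N (g : hom M N) :
  tensm T f N \co fmap (tens T V) g = fmap (tens T W) g \co tensm T f M.
Proof.
apply: tens_outP => v.
by rewrite -[LHS]compmA tens_fmapE compmA tensmE -[RHS]compmA tensmE tens_fmapE.
Qed.

(** After transposition this combines naturality of [tensm] with that of the counit. *)
Lemma cotm_nat V W (f : {linear V -> W}) M N (g : hom M N) :
  cotm H f N \co fmap (cot H W) g = fmap (cot H V) g \co cotm H f M.
Proof.
rewrite /cotm -adj_natl -adj_natr; congr adj.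
by rewrite -compmA tensm_nat compmA counit_nat -compmA.
Qed.

Lemma cot_unit_nat M N (g : hom M N) :
  cot_unit H N \co fmap (cot H k^o) g = g \co cot_unit H M.
Proof.
rewrite /cot_unit /act_unitV -compmA -tens_fmapE !compmA.
by congr (_ \co _); exact: (counit_nat (cot_adj H _) g).
Qed.

Lemma cot_unitV_nat M N (g : hom M N) :
  cot_unitV H N \co g = fmap (cot H k^o) g \co cot_unitV H M.
Proof. by rewrite /cot_unitV -adj_natl act_unit_nat adj_natr. Qed.

Lemma cot_assoc_nat V W M N (g : hom M N) :
  cot_assoc H V W N \co fmap (cot H V) (fmap (cot H W) g)
  = fmap (cot H (W \ot V)) g \co cot_assoc H V W M.
Proof.
rewrite /cot_assoc -adj_natl -adj_natr; congr adj.
rewrite -compmA act_assocV_nat !compmA; congr (_ \co _).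
rewrite -[LHS]compmA -fmapM. by rewrite counit_nat fmapM compmA counit_nat.
Qed.

Lemma cot_assocV_nat V W M N (g : hom M N) :
  cot_assocV H V W N \co fmap (cot H (W \ot V)) g
  = fmap (cot H V) (fmap (cot H W) g) \co cot_assocV H V W M.
Proof.
rewrite -[LHS]compm1 -(cot_assocVK H V W M) compmA
  (compm_sq _ (esym (cot_assoc_nat _ _ _))).
by rewrite cot_assocK comp1m.
Qed.

Lemma cot_psi_nat (A : algebra k) (C : coalgebra k) (psi : entwining A C)
    M N (g : hom M N) :
  cot_psi H psi N \co fmap (cot H C) (fmap (cot H A) g)
  = fmap (cot H A) (fmap (cot H C) g) \co cot_psi H psi M.
Proof.
rewrite /cot_psi (compm_sq _ (cot_assoc_nat _ _ _)) (compm_sq _ (cotm_nat _ _)).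
by rewrite cot_assocV_nat !compmA.
Qed.

End Naturality.

Lemma fmap_sq (k : fieldType) (S S' : lincat k) (F : functor S S')
    (M N N' P : S) (a : hom N P) (b : hom M N) (c : hom N' P) (d : hom M N') :
  a \co b = c \co d -> fmap F a \co fmap F b = fmap F c \co fmap F d.
Proof. by move=> e; rewrite -!fmapM e. Qed.

(** * Creation of entwined structures *)

Section Creation.
Variables (k : fieldType) (S : lincat k) (T : tensoring S) (H : cotensoring T).
Variables (A : algebra k) (C : coalgebra k) (psi : entwining A C).

Section JointlyMonic.
Variables (I : Type) (E : I -> entwined H psi) (P : S).
Variable p : forall i, hom P (eobj (E i)).
Variables (pi : hom (cot H C P) P) (mu : hom P (cot H A P)).
Hypothesis mp : jointly_monic p.
Hypothesis ppi : forall i, p i \co pi = econtra (E i) \co fmap (cot H C) (p i).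
Hypothesis pmu : forall i, eact (E i) \co p i = fmap (cot H A) (p i) \co mu.

Let Amp := right_adjoint_monic (cot_adj H A) mp.
Let AAmp := right_adjoint_monic (cot_adj H A) Amp.

(** Both laws compare maps into [P], so they may be tested after each [p i]; naturality moves [p i]
    to the source, where the law of [E i] applies. *)
Lemma monic_contra : is_contramodule pi.
Proof.
split; apply: mp => i.
  rewrite !compmA ppi (compm_sq _ (esym (cotm_nat _ _ _))).
  rewrite (compm_sq _ (esym (cot_unitV_nat _ _))) (econtraP (E i)).1.
  by rewrite comp1m compm1.
rewrite !compmA ppi (compm_sq _ (esym (cotm_nat _ _ _))).
rewrite (compm_sq _ (esym (cot_assoc_nat _ _ _ _))) (econtraP (E i)).2.
by rewrite -!compmA; congr (_ \co _); rewrite (fmap_sq _ (ppi i)).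
Qed.

(** Associativity compares maps into (A, (A, P)), hence the use of [AAmp]; the unit law compares
    endomorphisms of [P]. *)
Lemma monic_module : is_module mu.
Proof.
split; [apply: AAmp => i | apply: mp => i]; rewrite 2!compmA.
  rewrite -cot_assocV_nat (compm_sq _ (esym (cotm_nat _ _ _))) -[LHS]compmA.
  rewrite -pmu compmA (eactP (E i)).1 -compmA pmu compmA.
  by rewrite (fmap_sq _ (pmu i)) -compmA.
rewrite -(cot_unit_nat H (p i)) (compm_sq _ (esym (cotm_nat _ _ _))).
rewrite -[LHS]compmA.
by rewrite -pmu compmA (eactP (E i)).2 comp1m compm1.
Qed.

Lemma monic_entw :
  mu \co pi = fmap (cot H A) pi \co cot_psi H psi P \co fmap (cot H C) mu.
Proof.
apply: Amp => i; rewrite 3!compmA -pmu -compmA ppi compmA eentw.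
rewrite -[LHS]compmA (fmap_sq _ (pmu i)) (fmap_sq _ (ppi i)) compmA.
by rewrite (compm_sq _ (cot_psi_nat _ _ _)).
Qed.

Definition entwined_of_monic : entwined H psi :=
  Entwined monic_contra monic_module monic_entw.

Lemma entwined_of_monic_ehom i :
  is_ehom (M := entwined_of_monic) (N := E i) (p i).
Proof. exact/is_ehomP. Qed.

End JointlyMonic.

Section Epi.
Variables (E : entwined H psi) (Q : S) (p : hom (eobj E) Q).
Variables (pi : hom (cot H C Q) Q) (mu : hom Q (cot H A Q)).
Hypothesis ep : is_epi p.
Hypothesis Cep : is_epi (fmap (cot H C) p).
Hypothesis CCep : is_epi (fmap (cot H C) (fmap (cot H C) p)).
Hypothesis ppi : p \co econtra E = pi \co fmap (cot H C) p.
Hypothesis pmu : mu \co p = fmap (cot H A) p \co eact E.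

(** The unit law compares maps out of [Q], associativity maps out of (C, (C, Q)); this is where
    [CCep] enters. *)
Lemma epi_contra : is_contramodule pi.
Proof.
split.
  apply: ep; rewrite -compmA cot_unitV_nat compmA (compm_sq _ (cotm_nat _ _ _)).
  rewrite -ppi -!compmA (compmA (econtra E)) (econtraP E).1.
  by rewrite comp1m compm1.
apply: CCep; rewrite -compmA cot_assoc_nat compmA (compm_sq _ (cotm_nat _ _ _)).
rewrite -ppi -!compmA (compmA (econtra E)) (econtraP E).2.
by rewrite compmA ppi -!compmA (fmap_sq _ ppi).
Qed.

Lemma epi_module : is_module mu.
Proof.
split; apply: ep; rewrite -compmA pmu compmA (compm_sq _ (cotm_nat _ _ _)).
  rewrite cot_assocV_nat -!compmA (compmA (cot_assocV _ _ _ _)) (eactP E).1.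
  by rewrite pmu !compmA (fmap_sq _ pmu).
rewrite cot_unit_nat -2!compmA (compmA (cot_unit _ _)) (eactP E).2.
by rewrite comp1m compm1.
Qed.

Lemma epi_entw :
  mu \co pi = fmap (cot H A) pi \co cot_psi H psi Q \co fmap (cot H C) mu.
Proof.
apply: Cep; rewrite -compmA -ppi compmA pmu -compmA eentw.
rewrite -[RHS]compmA (fmap_sq _ pmu) [RHS]compmA.
rewrite (compm_sq _ (cot_psi_nat _ _ _)).
by rewrite [LHS]compmA [in LHS]compmA (fmap_sq _ ppi).
Qed.

Definition entwined_of_epi : entwined H psi :=
  Entwined epi_contra epi_module epi_entw.

Lemma entwined_of_epi_ehom : is_ehom (M := E) (N := entwined_of_epi) p.
Proof. exact/is_ehomP. Qed.

End Epi.

(** Shows that lifts found in the base category, and the injections of a biproduct, preserve the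
    structures. *)
Lemma ehom_of_monic (I : Type) (X P : entwined H psi) (E : I -> entwined H psi)
    (p : forall i, hom (eobj P) (eobj (E i))) (g : hom (eobj X) (eobj P)) :
  jointly_monic p -> (forall i, is_ehom (p i)) ->
  (forall i, is_ehom (p i \co g)) -> is_ehom g.
Proof.
move=> mp ep epg; apply/is_ehomP; split.
  apply: mp => i; have /is_ehomP[pC _] := ep i; have /is_ehomP[pgC _] := epg i.
  by rewrite !compmA pgC pC fmapM compmA.
apply: (right_adjoint_monic (cot_adj H A) mp) => i.
have /is_ehomP[_ pA] := ep i; have /is_ehomP[_ pgA] := epg i.
by rewrite !compmA -pA -fmapM -pgA compmA.
Qed.

(** The contramodule condition on [g] compares maps out of (C, Q), so it is tested on (C, p). *)
Lemma ehom_of_epi (E Q X : entwined H psi) (p : hom (eobj E) (eobj Q))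
    (g : hom (eobj Q) (eobj X)) :
  is_epi p -> is_epi (fmap (cot H C) p) -> is_ehom p -> is_ehom (g \co p) ->
  is_ehom g.
Proof.
move=> ep Cep /is_ehomP[pC pA] /is_ehomP[gpC gpA]; apply/is_ehomP; split.
  by apply: Cep; rewrite -!compmA -pC compmA gpC fmapM.
by apply: ep; rewrite -!compmA gpA pA compmA fmapM.
Qed.

Lemma cot0 (V : lmodType k) (M N : S) : fmap (cot H V) (0 : hom M N) = 0.
Proof. exact: (linear0 (mklin (cot_linear H V (M := M) (N := N)))). Qed.

(** The right adjoint (V, -) preserves kernels: transpose [x], lift it along [i], and transpose
    back. *)
Lemma cot_kernel_lift (V : lmodType k) (K M N X : S) (i : hom K M) (f : hom M N)
    (x : hom X (cot H V M)) :
  is_kernel i f -> fmap (cot H V) f \co x = 0 ->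
  exists y : hom X (cot H V K), fmap (cot H V) i \co y = x.
Proof.
move=> ki fx; have : f \co adjV (cot_adj H V) x = 0.
  apply: (can_inj (@adjK _ _ _ _ _ (cot_adj H V) _ _)).
  by rewrite adj_natr adjVK fx adjE cot0 comp0m.
case/(kernel_lift ki) => y iy; exists (adj (cot_adj H V) y).
by rewrite -adj_natr iy adjVK.
Qed.

Local Notation ecat := (entwined_category H psi).

(** * Zero object and biproducts *)

Lemma ehom_zero_object (Z : S) :
  is_zero_object Z -> exists E : ecat, is_zero_object E.
Proof.
move=> zZ; pose E (i : void) : entwined H psi := match i with end.
pose p (i : void) : hom Z (eobj (E i)) := match i with end.
(* For the empty family, joint monicity says that any two parallel maps into [Z] agree. *)
have mp : jointly_monic p.
  by move=> X g h _; have [_ [u [_ uP]]] := zZ X; rewrite -(uP g) // -(uP h).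
pose O : entwined H psi := @entwined_of_monic _ _ _ p 0 0 mp
  (fun i => match i with end) (fun i => match i with end).
exists O => X; split; exists 0; split=> // g _; apply: val_inj.
  by have [[u [_ uP]] _] := zZ (eobj X);
    rewrite -(uP (val g)) //; apply/esym/uP.
by have [_ [u [_ uP]]] := zZ (eobj X);
    rewrite -(uP (val g)) //; apply/esym/uP.
Qed.

Lemma ehom_biproduct (M N : entwined H psi) (P : S) (i1 : hom (eobj M) P)
    (i2 : hom (eobj N) P) (p1 : hom P (eobj M)) (p2 : hom P (eobj N)) :
  is_biproduct i1 i2 p1 p2 ->
  exists (E : ecat) (j1 : hom (M : ecat) E) (j2 : hom (N : ecat) E)
    (q1 : hom E (M : ecat)) (q2 : hom E (N : ecat)), is_biproduct j1 j2 q1 q2.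
Proof.
move=> [p1i1 p2i2 p1i2 p2i1 ip].
pose E (b : bool) := if b then M else N.
pose p b : hom P (eobj (E b)) :=
  if b return hom P (eobj (E b)) then p1 else p2.
have mp : jointly_monic p.
  move=> X g h e; rewrite -[g]comp1m -[h]comp1m -ip !compmDl -!compmA.
  by rewrite (e true) (e false).
(* The direct sum structures, the only ones for which the projections can be morphisms. *)
pose pi := i1 \co (econtra M \co fmap (cot H C) p1)
  + i2 \co (econtra N \co fmap (cot H C) p2).
pose mu := fmap (cot H A) i1 \co (eact M \co p1)
  + fmap (cot H A) i2 \co (eact N \co p2).
have ppi b : p b \co pi = econtra (E b) \co fmap (cot H C) (p b).
  case: b; rewrite /= /pi compmDr !compmA.
    by rewrite p1i1 p1i2 comp1m !comp0m addr0.
  by rewrite p2i2 p2i1 comp1m !comp0m add0r.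
have pmu b : eact (E b) \co p b = fmap (cot H A) (p b) \co mu.
  case: b; rewrite /= /mu compmDr !compmA -!fmapM.
    by rewrite p1i1 p1i2 cot0 fmap1 comp1m !comp0m addr0.
  by rewrite p2i2 p2i1 cot0 fmap1 comp1m !comp0m add0r.
pose B : entwined H psi := entwined_of_monic mp ppi pmu.
have eqp b : is_ehom (M := B) (N := E b) (p b) :=
  entwined_of_monic_ehom mp ppi pmu b.
have eq1 : is_ehom (M := B) (N := M) p1 := eqp true.
have eq2 : is_ehom (M := B) (N := N) p2 := eqp false.
(* Followed by the projections, an injection becomes an identity or zero, both of which are
   morphisms. *)
have ej1 : is_ehom (M := M) (N := B) i1.
  apply: (ehom_of_monic (P := B) mp eqp) => -[] /=.
    by rewrite p1i1; apply: (valP (eid M)).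
  by rewrite p2i1; apply: is_ehom0.
have ej2 : is_ehom (M := N) (N := B) i2.
  apply: (ehom_of_monic (P := B) mp eqp) => -[] /=.
    by rewrite p1i2; apply: is_ehom0.
  by rewrite p2i2; apply: (valP (eid N)).
exists B, (Sub i1 ej1 : ehom M B), (Sub i2 ej2 : ehom N B).
exists (Sub p1 eq1 : ehom B M), (Sub p2 eq2 : ehom B N).
by split; apply: val_inj.
Qed.

(** * Kernels *)

Section Kernels.
Variables (M N : entwined H psi) (f : ehom M N).

Lemma kernel_reflect (K : entwined H psi) (i : ehom K M) :
  is_kernel (val i) (val f) -> @is_kernel k ecat K M N i f.
Proof.
move=> ki; have mi := kernel_mono ki.
apply: mono_kernelP => [X g h gh||X g fg].
- by apply: val_inj; apply: mi; apply: (congr1 val gh).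
- by apply: val_inj; apply: ki.1.
have [h ih] := kernel_lift ki
  (congr1 val fg : val f \co val (g : ehom _ _) = 0).
have eh : is_ehom h.
  apply: (ehom_of_monic (I := unit) (E := fun=> M) (p := fun=> val i)).
  - by move=> Y a b /(_ tt); apply: mi.
  - by move=> _; apply: valP.
  - by move=> _; rewrite ih; apply: valP.
by exists (Sub h eh : ehom X K); apply: val_inj.
Qed.

Lemma ehom_kernel : abelian_category S ->
  exists (K : entwined H psi) (i : ehom K M), is_kernel (val i) (val f).
Proof.
move=> abS; have [K [i ki]] := kernel_ex abS (val f).
have /is_ehomP[fC fA] := valP f.
(* The structures of [M] restrict to [K]: [pi] is a lift along [i], [mu] a lift along (A, i). *)
have [|pi ipi] := kernel_lift ki (g := econtra M \co fmap (cot H C) i).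
  by rewrite compmA fC -compmA -fmapM ki.1 cot0 compm0.
have [|mu imu] := cot_kernel_lift (x := eact M \co i) ki.
  by rewrite compmA -fA -compmA ki.1 compm0.
have mi : jointly_monic (fun _ : unit => i).
  by move=> X g h /(_ tt); apply: (kernel_mono ki).
pose E := entwined_of_monic (E := fun=> M) mi (fun=> ipi) (fun=> esym imu).
have ei : is_ehom (M := E) (N := M) i := entwined_of_monic_ehom mi _ _ tt.
by exists E, (Sub i ei).
Qed.

End Kernels.

(** * Cokernels *)

Section Cokernels.
Hypotheses (abS : abelian_category S) (exC : exact_functor (cot H C)).
Variables (M N : entwined H psi) (f : ehom M N).

Lemma cokernel_reflect (Q : entwined H psi) (p : ehom N Q) :
  is_cokernel (val f) (val p) -> @is_cokernel k ecat M N Q f p.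
Proof.
move=> cp; have ep := cokernel_epi cp.
apply: epi_cokernelP => [X g h gh||X g gf].
- by apply: val_inj; apply: ep; apply: (congr1 val gh).
- by apply: val_inj; apply: cp.1.
have [h hp] := cokernel_desc cp
  (congr1 val gf : val (g : ehom _ _) \co val f = 0).
have eh : is_ehom h.
  apply: (ehom_of_epi ep (exact_epi abS exC ep) (valP p)).
  by rewrite hp; apply: valP.
by exists (Sub h eh : ehom Q X); apply: val_inj.
Qed.

Lemma ehom_cokernel :
  exists (Q : entwined H psi) (p : ehom N Q), is_cokernel (val f) (val p).
Proof.
have [Q [p cp]] := cokernel_ex abS (val f).
have /is_ehomP[fC fA] := valP f.
(* The contraaction must descend along (C, p), which is a cokernel of (C, f) by exactness; the
   action descends along [p] itself. *)
have [|pi pip] := cokernel_desc (exact_cokernel abS exC cp)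
  (g := p \co econtra N).
  by rewrite -compmA -fC compmA cp.1 comp0m.
have [|mu mup] := cokernel_desc cp (g := fmap (cot H A) p \co eact N).
  by rewrite -compmA fA compmA -fmapM cp.1 cot0 comp0m.
have ep := cokernel_epi cp; have Cep := exact_epi abS exC ep.
pose E := entwined_of_epi ep Cep (exact_epi abS exC Cep) (esym pip) mup.
have eP : is_ehom (M := N) (N := E) p := entwined_of_epi_ehom ep _ _ _ _.
by exists E, (Sub p eP).
Qed.

End Cokernels.

(** * Monomorphisms, epimorphisms and the abelian axioms *)

(** The kernel of [val f] in the base underlies a morphism [i] killed by [f], so [i = 0]; every map
    killed by [val f] factors through it and vanishes. *)
Lemma ehom_mono (M N : entwined H psi) (f : ehom M N) : abelian_category S ->
  @is_mono k ecat M N f -> is_mono (val f).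
Proof.
move=> abS mf; have [K [i ki]] := ehom_kernel f abS.
have i0 : i = 0 by apply: (mono_zero mf); apply: val_inj; apply: ki.1.
apply: mono_zeroP => X g /(kernel_lift ki)[h <-].
by rewrite i0 comp0m.
Qed.

Lemma ehom_epi (M N : entwined H psi) (f : ehom M N) : abelian_category S ->
  exact_functor (cot H C) -> @is_epi k ecat M N f -> is_epi (val f).
Proof.
move=> abS exC ef; have [Q [p cp]] := ehom_cokernel abS exC f.
have p0 : p = 0 by apply: (epi_zero ef); apply: val_inj; apply: cp.1.
apply: epi_zeroP => X g /(cokernel_desc cp)[h <-].
by rewrite p0 compm0.
Qed.

End Creation.

Theorem theorem3p9
    (k : fieldType) (char0 : [pchar k] =i pred0)
    (S : lincat k) (groth : grothendieck_category S)
    (T : tensoring S) (H : cotensoring T)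
    (A : algebra k) (C : coalgebra k) (psi : entwining A C)
    (exactC : exact_functor (cot H C)) :
  abelian_category (entwined_category H psi).
Proof.
have [abS _ _ _] := groth.
split=> [|M N|M N f|M N f mf|M N f ef].
- by have [[Z /ehom_zero_object zZ] _ _ _ _] := abS; apply: zZ.
- have [_ bip _ _ _] := abS.
  by have [P [i1 [i2 [p1 [p2]]]]] := bip (eobj M) (eobj N);
    apply: ehom_biproduct.
- have [K [i ki]] := ehom_kernel f abS.
  have [Q [p cp]] := ehom_cokernel abS exactC f.
  split; [exists K, i | exists Q, p]; first exact: kernel_reflect.
  exact: cokernel_reflect.
(* The mono [f] is mono in the base, hence there the kernel of its cokernel [p]; as [p] is a
   morphism, this kernel is reflected. *)
- have [Q [p cp]] := ehom_cokernel abS exactC f.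
  exists Q, p; apply: kernel_reflect.
  exact (mono_kernel abS (ehom_mono abS mf) cp).
- have [K [i ki]] := ehom_kernel f abS.
  exists K, i; apply: (cokernel_reflect abS exactC).
  exact (epi_cokernel abS (ehom_epi abS exactC ef) ki).
Qed.
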